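(* A $po$-$\Gamma$-semigroup $M$ is intra-regular and the ideals of $M$ form a chain (under inclusion) if and only if $M$ is a chain of simple semigroups.
   Context: A $po$-$\Gamma$-semigroup is a nonempty set $M$ with a nonempty set $\Gamma$ of binary operations on $M$, satisfying $(a\gamma b)\mu c=a\gamma(b\mu c)$ for all $a,b,c\in M$ and $\gamma,\mu\in\Gamma$, and a partial order $\le$ on $M$ such that $a\le b$ implies $a\gamma c\le b\gamma c$ and $c\gamma a\le c\gamma b$ for all $c\in M$, $\gamma\in\Gamma$. For $A,B\subseteq M$, $A\Gamma B=\{a\gamma b\mid a\in A,\ b\in B,\ \gamma\in\Gamma\}$ (and similarly for longer products, with singletons written as elements; e.g. $M\Gamma x\gamma x\Gamma M=\{a\delta x\gamma x\xi b\mid a,b\in M,\ \delta,\xi\in\Gamma\}$ for fixed $\gamma$). For $H\subseteq M$, $(H]=\{t\in M\mid t\le a \text{ for some } a\in H\}$. $M$ is intra-regular if $x\in(M\Gamma x\gamma x\Gamma M]$ for every $x\in M$ and every $\gamma\in\Gamma$. An ideal of $M$ is a nonempty subset $A$ with $M\Gamma A\subseteq A$, $A\Gamma M\subseteq A$, and such that $a\in A$, $b\in M$, $b\le a$ imply $b\in A$. A subsemigroup of $M$ is a nonempty subset $A$ with $A\Gamma A\subseteq A$; it is itself a $po$-$\Gamma$-semigroup with the restricted operations and order. A $po$-$\Gamma$-semigroup is simple if it is the only ideal of itself; a subsemigroup is simple if it is simple as a $po$-$\Gamma$-semigroup in its own right. A congruence on $M$ is an equivalence relation $\sigma$ such that $(a,b)\in\sigma$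 implies $(a\gamma c,b\gamma c)\in\sigma$ and $(c\gamma a,c\gamma b)\in\sigma$ for all $c\in M$, $\gamma\in\Gamma$. It is a semilattice congruence if $(a\gamma b,b\gamma a)\in\sigma$ and $(a\gamma a,a)\in\sigma$ for all $a,b\in M$, $\gamma\in\Gamma$. $(x)_\sigma$ denotes the $\sigma$-class of $x$. $M$ is a chain of simple semigroups if there is a semilattice congruence $\sigma$ on $M$ such that $(x)_\sigma$ is a simple subsemigroup of $M$ for every $x\in M$, and for all $x,y\in M$ and all $\gamma\in\Gamma$ we have $(x)_\sigma=(x\gamma y)_\sigma$ or $(y)_\sigma=(x\gamma y)_\sigma$. *)

(* Defs.v *)
From HB Require Import structures.
From mathcomp Require Import all_boot all_order.
From mathcomp Require Import boolp classical_sets.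

Set Implicit Arguments.
Unset Strict Implicit.
Unset Printing Implicit Defensive.

Import Order.Theory.
Local Open Scope classical_set_scope.
Local Open Scope order_scope.

(* A subset [A : set M], used as a type, unfolds to [{x : M | x \in A}]. *)
HB.instance Definition _ (d : Order.disp_t) (M : porderType d) (P : pred M) :=
  [SubChoice_isSubPOrder of {x : M | P x} by <: with d].

Section PoGammaSemigroup.
Context {d : Order.disp_t} {M : porderType d}.
Implicit Types (Gamma : set (M -> M -> M)) (A B H : set M).

Record po_Gamma_semigroup Gamma : Prop := PoGammaSemigroup {
  carrier_nonempty : [set: M] !=set0;
  Gamma_nonempty : Gamma !=set0;
  Gamma_assoc : forall g m, Gamma g -> Gamma m ->
    forall a b c : M, m (g a b) c = g a (m b c);
  Gamma_monol : forall g, Gamma g ->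
    forall a b c : M, a <= b -> g a c <= g b c;
  Gamma_monor : forall g, Gamma g ->
    forall a b c : M, a <= b -> g c a <= g c b }.

Definition Gamma_mul Gamma A B : set M :=
  \bigcup_(g in Gamma) [set g a b | a in A & b in B].

Definition down_closure H : set M := [set t | exists2 a, H a & t <= a].

(* The order of multiplication in [M Gamma x g x Gamma M] is immaterial, by
   associativity. *)
Definition intra_regular Gamma : Prop :=
  forall (x : M) g, Gamma g ->
    down_closure
      (Gamma_mul Gamma (Gamma_mul Gamma [set: M] [set g x x]) [set: M]) x.

Record po_ideal Gamma A : Prop := PoIdeal {
  ideal_nonempty : A !=set0;
  ideal_mull : Gamma_mul Gamma [set: M] A `<=` A;
  ideal_mulr : Gamma_mul Gamma A [set: M] `<=` A;
  ideal_down : forall a b, A a -> b <= a -> A b }.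

Definition simple Gamma : Prop :=
  forall I : set M, po_ideal Gamma I <-> I = [set: M].

Record subsemigroup Gamma A : Prop := Subsemigroup {
  subsemigroup_nonempty : A !=set0;
  subsemigroup_mul : Gamma_mul Gamma A A `<=` A }.

End PoGammaSemigroup.

Section Semilattice.
Context {d : Order.disp_t} {M : porderType d}.
Implicit Types (Gamma : set (M -> M -> M)) (A : set M).

(* Operations of [Gamma] that agree on [A] have the same restriction. *)
Definition restrict_Gamma Gamma A : set (A -> A -> A) :=
  [set h | exists2 g, Gamma g & forall x y, \val (h x y) = g (\val x) (\val y)].
Arguments restrict_Gamma Gamma A _ : clear implicits.

Lemma restrict_po_Gamma_semigroup Gamma A :
  po_Gamma_semigroup Gamma -> subsemigroup Gamma A ->
  po_Gamma_semigroup (restrict_Gamma Gamma A).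
Proof.
case=> _ [g Gg] gA gl gr [[a Aa] AA]; split.
- by exists (Sub a (mem_set Aa)).
- have cl (x y : A) : g (\val x) (\val y) \in A.
    apply/mem_set/AA; exists g => //.
    exists (\val x); first exact: set_mem (valP x).
    by exists (\val y) => //; exact: set_mem (valP y).
  by exists (fun x y => Sub (g (\val x) (\val y)) (cl x y)); exists g.
- move=> h k [h' Gh hE] [k' Gk kE] x y z; apply: val_inj.
  by rewrite kE !hE kE; exact: (gA _ _ Gh Gk).
- by move=> h [h' Gh hE] x y z; rewrite -!Order.le_val !hE; exact: (gl _ Gh).
- by move=> h [h' Gh hE] x y z; rewrite -!Order.le_val !hE; exact: (gr _ Gh).
Qed.

Definition simple_subsemigroup Gamma A : Prop :=
  subsemigroup Gamma A /\ simple (restrict_Gamma Gamma A).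

Record congruence Gamma (s : M -> M -> Prop) : Prop := Congruence {
  congruence_equiv : RelationClasses.Equivalence s;
  congruence_mulr : forall a b c g, Gamma g -> s a b -> s (g a c) (g b c);
  congruence_mull : forall a b c g, Gamma g -> s a b -> s (g c a) (g c b) }.

Record semilattice_congruence Gamma (s : M -> M -> Prop) : Prop :=
  SemilatticeCongruence {
    semilattice_congr : congruence Gamma s;
    semilattice_comm : forall a b g, Gamma g -> s (g a b) (g b a);
    semilattice_idem : forall a g, Gamma g -> s (g a a) a }.

Definition eq_class (s : M -> M -> Prop) (x : M) : set M := [set y | s x y].

Definition chain_of_simple_semigroups Gamma : Prop :=
  exists s : M -> M -> Prop,
    [/\ semilattice_congruence Gamma s,
        forall x, simple_subsemigroup Gamma (eq_class s x)
      & forall x y g, Gamma g ->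
          eq_class s x = eq_class s (g x y) \/
          eq_class s y = eq_class s (g x y)].

End Semilattice.

(* Main.v *)
Require Import Defs.
From mathcomp Require Import all_boot all_order.
From mathcomp Require Import boolp classical_sets.

(** Both directions rest on one description of simplicity: a
    po-Gamma-semigroup is simple exactly when every element lies below a
    product of the form [u g x h v], for every [x] ([simpleP]).  Applied to the
    restricted operations it says the same of a subsemigroup, with the outer
    factors [u] and [v] taken inside it ([simple_subsemigroupP]).

    Suppose [M] is intra-regular with its ideals in a chain.  Intra-regularity
    makes every ideal semiprime: it contains [x] as soon as it contains
    [g x x].  Membership of a product [g x y] in an ideal then depends neither
    on the order of the factors nor on the operation [g], because
    [(y m x) g (y m x)] has [x g y] as an inner factor.  It follows that
    "generating the same principal ideal" ([same_ideal]) is a semilattice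
    congruence.  Its classes are simple: if [c] and [j] are in one class, so is
    the cube of [j], hence [c <= a j j j b] for some [a] and [b], and the
    factors [a j] and [j b] are again in the class, as they lie, in the
    divisibility preorder, between [c] and [j].  Finally, if [x] is in the
    principal ideal of [y] then [x] and [g x y] generate the same ideal; when
    the ideals form a chain this applies to [x, y] or to [y, x].

    Conversely, let [M] be a chain of simple semigroups.  Simplicity of the
    class of [x], applied to its elements [g x x] and [x], is
    intra-regularity.  Moreover an ideal that meets a class contains it.  If [a]
    is in the ideal [A] and [b] in the ideal [B], then [g a b] is in both
    ideals and in the class of [a] or of [b]; so [a] is in [B] or [b] is in
    [A]. *)

Set Implicit Arguments.
Unset Strict Implicit.
Unset Printing Implicit Defensive.

Import Order.Theory.
Local Open Scope classical_set_scope.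
Local Open Scope order_scope.

(** * Simplicity by two-sided multiples *)

Section Simplicity.
Context {d : Order.disp_t} {M : porderType d}.
Implicit Types (Gamma : set (M -> M -> M)) (A B : set M).

(** For [A = M] and [x] a square, the set in the definition of
    intra-regularity; restricting the outer factors to a subsemigroup [A] gives
    the corresponding set for [A], up to its elements outside [A]. *)
Definition sandwich Gamma A (x : M) : set M :=
  down_closure (Gamma_mul Gamma (Gamma_mul Gamma A [set x]) A).

Lemma sandwichP Gamma A x y :
  sandwich Gamma A x y <->
  exists g h u v, [/\ Gamma g, Gamma h, A u, A v & y <= h (g u x) v].
Proof.
split.
  move=> [_ [h Gh [_ [g Gg [u Au [_ -> <-]]] [v Av <-]]] yle].
  by exists g, h, u, v.
move=> [g [h [u [v [Gg Gh Au Av yle]]]]]; exists (h (g u x) v) => //.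
exists h => //; exists (g u x); last by exists v.
by exists g => //; exists u => //; exists x.
Qed.

Lemma po_ideal_le Gamma A a b : po_ideal Gamma A -> a <= b -> A b -> A a.
Proof. by move=> iA ab Ab; exact: (ideal_down iA Ab ab). Qed.

Lemma po_ideal_mull Gamma A g a b :
  po_ideal Gamma A -> Gamma g -> A b -> A (g a b).
Proof.
by move=> iA Gg Ab; apply: (ideal_mull iA); exists g => //; exists a => //; exists b.
Qed.

Lemma po_ideal_mulr Gamma A g a b :
  po_ideal Gamma A -> Gamma g -> A a -> A (g a b).
Proof.
by move=> iA Gg Aa; apply: (ideal_mulr iA); exists g => //; exists a => //; exists b.
Qed.

Lemma po_ideal_sandwich Gamma A B x y :
  po_ideal Gamma A -> A x -> sandwich Gamma B x y -> A y.
Proof.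
move=> iA Ax /sandwichP[g [h [u [v [Gg Gh _ _ yle]]]]].
apply: (po_ideal_le iA yle).
exact: (po_ideal_mulr _ iA Gh (po_ideal_mull _ iA Gg Ax)).
Qed.

(** The product [x x x] witnesses nonemptiness; the outer factors absorb
    multiplications by associativity. *)
Lemma sandwich_po_ideal Gamma x :
  po_Gamma_semigroup Gamma -> po_ideal Gamma (sandwich Gamma [set: M] x).
Proof.
case=> _ [k Gk] gA gl gr; split.
- by exists (k (k x x) x); apply/sandwichP; exists k, k, x, x.
- move=> _ [m Gm [a _ [t /sandwichP[g [h [u [v [Gg Gh _ _ tle]]]]] <-]]].
  apply/sandwichP; exists g, h, (m a u), v; split => //.
  by rewrite (gA _ _ Gm Gg) (gA _ _ Gm Gh); apply: gr.
- move=> _ [m Gm [t /sandwichP[g [h [u [v [Gg Gh _ _ tle]]]]] [a _ <-]]].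
  apply/sandwichP; exists g, h, u, (m v a); split => //.
  by rewrite -(gA _ _ Gh Gm); apply: gl.
- move=> t y /sandwichP[g [h [u [v [Gg Gh _ _ tle]]]]] yt.
  by apply/sandwichP; exists g, h, u, v; split => //; exact: le_trans tle.
Qed.

(** In a simple semigroup the ideal [sandwich Gamma setT x] is everything;
    conversely an ideal absorbs the sandwiches of any element it contains. *)
Lemma simpleP Gamma : po_Gamma_semigroup Gamma ->
  simple Gamma <-> forall x y, sandwich Gamma [set: M] x y.
Proof.
move=> sM; split=> [simM x y|full I].
  by have /simM -> := sandwich_po_ideal x sM.
split=> [iI|->].
  rewrite -subTset => y _; have [i Ii] := ideal_nonempty iI.
  exact: (po_ideal_sandwich iI Ii (full i y)).
by split=> //; exact: (carrier_nonempty sM).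
Qed.

End Simplicity.

(** * Simple subsemigroups *)

Section Subsemigroup.
Context {d : Order.disp_t} {M : porderType d}.
Variable Gamma : set (M -> M -> M).
Hypothesis sM : po_Gamma_semigroup Gamma.
Implicit Types (A I : set M).

Lemma subsemigroup_op A g a b :
  subsemigroup Gamma A -> Gamma g -> A a -> A b -> A (g a b).
Proof.
by move=> sA Gg Aa Ab; apply: (subsemigroup_mul sA); exists g => //; exists a => //; exists b.
Qed.

Lemma restrict_op A g : subsemigroup Gamma A -> Gamma g ->
  exists2 h : A -> A -> A, restrict_Gamma Gamma (A := A) h &
    forall x y, \val (h x y) = g (\val x) (\val y).
Proof.
move=> sA Gg.
have cl (x y : A) : g (\val x) (\val y) \in A.
  by apply/mem_set/(subsemigroup_op sA Gg); apply: set_mem; apply: valP.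
by exists (fun x y => Sub (g (\val x) (\val y)) (cl x y)) => //; exists g.
Qed.

(** Replaces simplicity of the subtype by a statement about elements of [M]. *)
Lemma simple_subsemigroupP A : subsemigroup Gamma A ->
  simple (restrict_Gamma Gamma (A := A)) <->
  forall x y, A x -> A y -> sandwich Gamma A x y.
Proof.
move=> sA; rewrite (simpleP (restrict_po_Gamma_semigroup sM sA)).
split=> full x y.
  move=> Ax Ay.
  have /sandwichP[g [h [u [v [[g' Gg gE] [h' Gh hE] _ _]]]]] :=
    full (Sub x (mem_set Ax)) (Sub y (mem_set Ay)).
  rewrite -Order.le_val hE gE !SubK => yle.
  by apply/sandwichP; exists g', h', (\val u), (\val v);
    split => //; exact: (set_mem (valP _)).
have /sandwichP[g [h [u [v [Gg Gh Au Av yle]]]]] :=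
  full _ _ (set_mem (valP x)) (set_mem (valP y)).
have [g' Gg' gE] := restrict_op sA Gg; have [h' Gh' hE] := restrict_op sA Gh.
apply/sandwichP; exists g', h', (Sub u (mem_set Au)), (Sub v (mem_set Av)).
by split => //; rewrite -Order.le_val hE gE !SubK.
Qed.

(** The ideal meets [A] in some [x], and everything in [A] is below a multiple
    of [x]. *)
Lemma po_ideal_simple_subsemigroup A I : simple_subsemigroup Gamma A ->
  po_ideal Gamma I -> A `&` I !=set0 -> A `<=` I.
Proof.
move=> [sA /(simple_subsemigroupP sA) full] iI [x [Ax Ix]] y Ay.
exact: (po_ideal_sandwich iI Ix (full x y Ax Ay)).
Qed.

End Subsemigroup.

(** * Principal ideals of intra-regular semigroups *)

Section IntraRegular.
Context {d : Order.disp_t} {M : porderType d}.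
Variable Gamma : set (M -> M -> M).
Hypotheses (sM : po_Gamma_semigroup Gamma) (rM : intra_regular Gamma).
Implicit Types (A : set M).

(** [principal_le x y] is membership of [x] in the principal ideal of [y]. *)
Definition principal_le (x y : M) : Prop :=
  forall A, po_ideal Gamma A -> A y -> A x.

Definition same_ideal (x y : M) : Prop := principal_le x y /\ principal_le y x.

Lemma principal_le_trans x y z :
  principal_le x y -> principal_le y z -> principal_le x z.
Proof. by move=> xy yz A iA /(yz A iA)/(xy A iA). Qed.

Lemma principal_le_mulr g x y : Gamma g -> principal_le (g x y) x.
Proof. by move=> Gg A iA; apply: (po_ideal_mulr _ iA Gg). Qed.

Lemma principal_le_mull g x y : Gamma g -> principal_le (g x y) y.
Proof. by move=> Gg A iA; apply: (po_ideal_mull _ iA Gg). Qed.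

Lemma principal_po_ideal y : po_ideal Gamma [set x | principal_le x y].
Proof.
split.
- by exists y => A.
- move=> _ [g Gg [a _ [b yb <-]]].
  exact: (principal_le_trans (principal_le_mull _ Gg) yb).
- move=> _ [g Gg [a ya [b _ <-]]].
  exact: (principal_le_trans (principal_le_mulr _ Gg) ya).
- by move=> a b ya ba A iA Ay; apply: (po_ideal_le iA ba); apply: ya.
Qed.

Lemma same_ideal_equiv : RelationClasses.Equivalence same_ideal.
Proof.
split=> [x|x y [xy yx]|x y z [xy yx] [yz zy]]; first by split=> A.
  by split.
by split; [exact: (principal_le_trans xy yz) | exact: (principal_le_trans zy yx)].
Qed.

Lemma intra_regular_semiprime A g x :
  po_ideal Gamma A -> Gamma g -> A (g x x) -> A x.
Proof. by move=> iA Gg Axx; apply: (po_ideal_sandwich iA Axx (rM x Gg)). Qed.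

Lemma same_ideal_idem g x : Gamma g -> same_ideal (g x x) x.
Proof.
move=> Gg; split; first exact: principal_le_mulr.
by move=> A iA; apply: (intra_regular_semiprime iA Gg).
Qed.

Lemma principal_le_comm g h x y :
  Gamma g -> Gamma h -> principal_le (h y x) (g x y).
Proof.
move=> Gg Gh A iA Axy; apply: (intra_regular_semiprime iA Gg).
(* The inner factor is [g x y]: [(y h x) g (y h x) = y h ((x g y) h x)]. *)
rewrite (Gamma_assoc sM Gh Gg) -(Gamma_assoc sM Gg Gh).
exact: (po_ideal_mull _ iA Gh (po_ideal_mulr _ iA Gh Axy)).
Qed.

(** This ideal makes [same_ideal] a congruence: it contains every element of the
    principal ideal of [a].  Its closure under multiplication on the right needs
    [principal_le_comm], hence intra-regularity. *)
Lemma residual_po_ideal A g c a : po_ideal Gamma A -> Gamma g ->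
  A (g a c) -> po_ideal Gamma [set t | A (g t c)].
Proof.
move=> iA Gg Aac; split.
- by exists a.
- move=> _ [h Gh [m _ [t At <-]]] /=.
  by rewrite (Gamma_assoc sM Gh Gg); apply: (po_ideal_mull _ iA Gh).
- move=> _ [h Gh [t At [m _ <-]]] /=.
  apply: (principal_le_comm Gg Gg iA).
  rewrite -(Gamma_assoc sM Gg Gh); apply: (po_ideal_mulr _ iA Gh).
  exact: (principal_le_comm Gg Gg iA At).
- by move=> t b At bt; apply: (ideal_down iA At); apply: (Gamma_monol sM Gg).
Qed.

Lemma principal_le_mul2r g a b c :
  Gamma g -> principal_le a b -> principal_le (g a c) (g b c).
Proof. by move=> Gg ab A iA Abc; exact: (ab _ (residual_po_ideal iA Gg Abc) Abc). Qed.

Lemma principal_le_mul2l g a b c :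
  Gamma g -> principal_le a b -> principal_le (g c a) (g c b).
Proof.
move=> Gg ab; apply: (principal_le_trans (principal_le_comm Gg Gg)).
exact: (principal_le_trans (principal_le_mul2r Gg ab) (principal_le_comm Gg Gg)).
Qed.

Lemma same_ideal_semilattice : semilattice_congruence Gamma same_ideal.
Proof.
split=> [|a b g Gg|a g Gg]; last exact: same_ideal_idem.
  split; first exact: same_ideal_equiv.
    by move=> a b c g Gg [ab ba]; split; apply: principal_le_mul2r.
  by move=> a b c g Gg [ab ba]; split; apply: principal_le_mul2l.
by split; apply: principal_le_comm.
Qed.

(** The principal ideal of [x] is that of [g x x], and it can only grow when one
    of the two factors is replaced by [y]. *)
Lemma same_ideal_mul_of_le g x y :
  Gamma g -> principal_le x y -> same_ideal x (g x y) /\ same_ideal x (g y x).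
Proof.
move=> Gg xy.
have xx := (same_ideal_idem x Gg).2.
split; split; try solve [exact: principal_le_mulr | exact: principal_le_mull].
  exact: (principal_le_trans xx (principal_le_mul2l Gg xy)).
exact: (principal_le_trans xx (principal_le_mul2r Gg xy)).
Qed.

Lemma same_ideal_class_subsemigroup x :
  subsemigroup Gamma (eq_class same_ideal x).
Proof.
split; first by exists x; split=> A.
move=> _ [g Gg [a [xa ax] [b [xb bx] <-]]].
have [[ab ba] _] := same_ideal_mul_of_le Gg (principal_le_trans ax xb).
by split; [exact: (principal_le_trans xa ab) | exact: (principal_le_trans ba ax)].
Qed.

Lemma same_ideal_class_simple x :
  simple_subsemigroup Gamma (eq_class same_ideal x).
Proof.
have sC := same_ideal_class_subsemigroup x.
split=> //; apply/(simple_subsemigroupP sM sC) => j c Cj Cc.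
have [[xj jx] [xc cx]] := (Cj, Cc).
have [k Gk] := Gamma_nonempty sM.
pose w := k (k j j) j.
have [xw wx] : eq_class same_ideal x w.
  by do 2?[apply: (subsemigroup_op sC) => //].
(* The ideal [M w M] contains the fourth power of [w], hence [w] because it is
   semiprime, hence [c]. *)
have iT := sandwich_po_ideal w sM.
have Tw : sandwich Gamma [set: M] w w.
  apply: (intra_regular_semiprime iT Gk); apply: (intra_regular_semiprime iT Gk).
  by apply/sandwichP; exists k, k, w, (k w w); split; rewrite ?(Gamma_assoc sM Gk Gk).
have := principal_le_trans cx xw iT Tw.
move=> /sandwichP[g [h [a [b [Gg Gh _ _]]]]].
have -> : h (g a w) b = k (k (g a j) j) (h j b).
  by rewrite /w -!(Gamma_assoc sM Gg Gk) -(Gamma_assoc sM Gk Gh).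
move=> cle; apply/sandwichP; exists k, k, (g a j), (h j b); split=> //.
- split; last exact: (principal_le_trans (principal_le_mull _ Gg) jx).
  apply: (principal_le_trans xc) => A iA Au; apply: (po_ideal_le iA cle).
  exact: (po_ideal_mulr _ iA Gk (po_ideal_mulr _ iA Gk Au)).
- split; last exact: (principal_le_trans (principal_le_mulr _ Gh) jx).
  apply: (principal_le_trans xc) => A iA Av; apply: (po_ideal_le iA cle).
  exact: (po_ideal_mull _ iA Gk).
Qed.

Lemma principal_le_total : total_on (po_ideal Gamma) subset ->
  forall x y, principal_le x y \/ principal_le y x.
Proof.
move=> tot x y.
have [sub|sub] := tot _ _ (principal_po_ideal x) (principal_po_ideal y).
  by left; apply: (sub x) => A.
by right; apply: (sub y) => A.
Qed.

End IntraRegular.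

(** * Chains of simple semigroups *)

Lemma eq_class_eq (T : Type) (s : T -> T -> Prop) x y :
  RelationClasses.Equivalence s -> s x y -> [set z | s x z] = [set z | s y z].
Proof.
case=> _ sS sT xy; apply/seteqP; split=> z /=; last exact: sT.
by apply: sT; apply: sS.
Qed.

Theorem theorem16 (d : Order.disp_t) (M : porderType d)
    (Gamma : set (M -> M -> M)) (hM : po_Gamma_semigroup Gamma) :
  (intra_regular Gamma /\ total_on (po_ideal Gamma) subset) <->
  chain_of_simple_semigroups Gamma.
Proof.
split=> [[rM tot]|[s [ss simC chainC]]].
  have eqv := same_ideal_equiv Gamma.
  exists (same_ideal Gamma); split; first exact: same_ideal_semilattice.
    exact: same_ideal_class_simple.
  move=> x y g Gg; have [xy|yx] := principal_le_total tot x y.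
    left; apply: (eq_class_eq eqv).
    exact: (same_ideal_mul_of_le hM rM Gg xy).1.
  right; apply: (eq_class_eq eqv).
  exact: (same_ideal_mul_of_le hM rM Gg yx).2.
have [sR sS _] := congruence_equiv (semilattice_congr ss).
split=> [x g Gg|A B iA iB].
  have [sC /(simple_subsemigroupP hM sC) full] := simC x.
  have Cx : eq_class s x x by exact: sR.
  have Cxx : eq_class s x (g x x) by exact: (subsemigroup_op sC Gg Cx Cx).
  have /sandwichP[h [k [u [v [Gh Gk _ _ xle]]]]] := full _ _ Cxx Cx.
  by apply/sandwichP; exists h, k, u, v.
have [g Gg] := Gamma_nonempty hM.
have [AB|/existsNP[a /not_implyP[Aa nBa]]] := pselect (A `<=` B); first by left.
right=> b Bb.
have Aab : A (g a b) by apply: (po_ideal_mulr _ iA Gg).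
have Bab : B (g a b) by apply: (po_ideal_mull _ iB Gg).
have [Ca|Cb] := chainC a b g Gg.
  case: nBa; apply: (po_ideal_simple_subsemigroup hM (simC a) iB); last exact: sR.
  by exists (g a b); split; first by rewrite Ca; exact: sR.
apply: (po_ideal_simple_subsemigroup hM (simC b) iA); last exact: sR.
by exists (g a b); split; first by rewrite Cb; exact: sR.
Qed.
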